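(* Let $m$ be a positive even integer and let $\mathbb{F}_{3^{2m+1}}$ be the finite field with $3^{2m+1}$ elements. Then there exist signed difference sets with parameters $(3^{2m+1},3^{2m}+1,1)$ in the additive group $G=(\mathbb{F}_{3^{2m+1}},+)$.
   Context: For a finite group $G$ of order $v$, with identity written $0_G$, a subset $S\subseteq G$ is identified with $\sum_{s\in S}s$ in the group ring $\mathbb{Z}[G]$. Let $D=\sum_{i=1}^k s_id_i\in\mathbb{Z}[G]$ with distinct $d_i\in G$ and $s_i\in\{-1,1\}$, and put $D^{-1}=\sum_i s_id_i^{-1}$, where $d_i^{-1}$ is the inverse in $G$. $D$ is a $(v,k,\lambda)$-signed difference set in $G$ if $DD^{-1}=\lambda G+(k-\lambda)\cdot 0_G$, where $\lambda$ is an integer. *)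

(* Defs.v *)
From HB Require Import structures.
From mathcomp Require Import all_boot all_order all_algebra all_fingroup.

Set Implicit Arguments.
Unset Strict Implicit.
Unset Printing Implicit Defensive.

Import GRing.Theory.
Local Open Scope ring_scope.

(* The integral group ring Z[gT]: the element \sum_g a_g g is the function
   g |-> a_g. The alias is needed because {ffun gT -> int} itself carries the
   pointwise product, whereas here the product is convolution. *)
Definition zgring (gT : finGroupType) : Type := {ffun gT -> int}.

HB.instance Definition _ (gT : finGroupType) :=
  GRing.Zmodule.copy (zgring gT) {ffun gT -> int}.

Section GroupRing.
Variable gT : finGroupType.
Implicit Types (x y z : zgring gT) (g h : gT).

Definition zg_elt g : zgring gT := [ffun h => (h == g)%:R].

Definition zg_set (S : {set gT}) : zgring gT := \sum_(g in S) zg_elt g.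

Definition zg_mul x y : zgring gT :=
  [ffun g => \sum_h x h * y (h^-1 * g)%g].

Lemma zg_mulA : associative zg_mul.
Proof.
move=> x y z; apply/ffunP=> g; rewrite !ffunE.
under [RHS]eq_bigr => k _ do rewrite ffunE mulr_suml.
rewrite exchange_big /=; apply: eq_bigr => h _.
rewrite ffunE mulr_sumr (reindex_inj (mulgI h^-1)%g) /=.
by apply: eq_bigr => k _; rewrite invMg invgK -mulgA mulKVg mulrA.
Qed.

Lemma zg_mul1l : left_id (zg_elt 1%g) zg_mul.
Proof.
move=> x; apply/ffunP=> g; rewrite ffunE (bigD1 1%g) //= ffunE eqxx mul1r.
rewrite invg1 mul1g big1 ?addr0 // => h /negPf h1.
by rewrite ffunE h1 mul0r.
Qed.

Lemma zg_mul1r : right_id (zg_elt 1%g) zg_mul.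
Proof.
move=> x; apply/ffunP=> g; rewrite ffunE (bigD1 g) //= ffunE mulVg eqxx mulr1.
rewrite big1 ?addr0 // => h hg; rewrite ffunE -eq_mulVg1.
by rewrite (negPf hg) mulr0.
Qed.

Lemma zg_mulDl : left_distributive zg_mul +%R.
Proof.
move=> x y z; apply/ffunP=> g; rewrite !ffunE -big_split /=.
by apply: eq_bigr => h _; rewrite ffunE mulrDl.
Qed.

Lemma zg_mulDr : right_distributive zg_mul +%R.
Proof.
move=> x y z; apply/ffunP=> g; rewrite !ffunE -big_split /=.
by apply: eq_bigr => h _; rewrite ffunE mulrDr.
Qed.

HB.instance Definition _ := GRing.Zmodule_isPzRing.Build (zgring gT)
  zg_mulA zg_mul1l zg_mul1r zg_mulDl zg_mulDr.

Lemma zg_eltM g h : zg_elt g * zg_elt h = zg_elt (g * h)%g.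
Proof.
apply/ffunP=> k; rewrite ffunE (bigD1 g) //= big1 => [|l /negPf lg].
  by rewrite !ffunE eqxx mul1r addr0 -(inj_eq (mulgI g)) mulKVg.
by rewrite ffunE lg mul0r.
Qed.

Definition signed_sum k (s : 'I_k -> int) (d : 'I_k -> gT) : zgring gT :=
  \sum_(i < k) zg_elt (d i) *~ s i.

Definition signed_difference_set (v k : nat) (lam : int) (D : zgring gT) : Prop :=
  #|gT| = v /\
  exists (s : 'I_k -> int) (d : 'I_k -> gT),
    [/\ injective d,
        forall i, s i = -1 \/ s i = 1,
        D = signed_sum s d &
        D * signed_sum s (fun i => (d i)^-1%g)
          = zg_set [set: gT] *~ lam + zg_elt 1%g *~ (k%:Z - lam)].

End GroupRing.

(* The canonical finGroupType structure on the carrier of a finite field is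
   its additive group, so that mulg is + and 1%g is 0. *)
Definition additive_group (F : finFieldType) : finGroupType := F.

Lemma additive_groupE (F : finFieldType) (x y : additive_group F) :
  [/\ (x * y)%g = (x : F) + (y : F), 1%g = 0 :> F & (x^-1)%g = - (x : F)].
Proof. by []. Qed.

(* Main.v *)
(** Put q = 3^m and let η be the quadratic character of F_q, extended by
    η(0) = 0. Up to an isomorphism of additive groups, F_(3^(2m+1)) is
    F_q × F_q × Z_3, and we take

      D(x, y, 0) = [x = 0],  D(x, y, 1) = [y = 0],  D(x, y, 2) = η(x) η(y).

    The autocorrelation of η is q[a = 0] - 1, so the three layers, correlated
    with themselves, contribute q[a = 0], q[b = 0] and
    (q[a = 0] - 1)(q[b = 0] - 1), which add up to q² [a = b = 0] + 1. Among the
    correlations of distinct layers, those involving the third one vanish as η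
    has sum 0, and those of the first two are constantly 1. Hence
    D D^-1 = G + q² 0_G. *)

Require Import Defs.
From mathcomp Require Import all_boot all_order all_algebra all_fingroup.
From mathcomp Require Import all_solvable all_field ring zify.

Import GRing.Theory.

(** * Correlations as coefficients in the group ring *)

Section Correlation.
Local Open Scope ring_scope.

(** The coefficient of [g] in the product of [u] with the image of [w] under inversion, both read as
    group ring elements. *)
Definition corr (gT : finGroupType) (u w : gT -> int) (g : gT) : int :=
  \sum_h u h * w (g^-1 * h)%g.

Lemma corr_prod (gT hT : finGroupType) (u w : gT -> int) (u' w' : hT -> int)
    (g : gT * hT) :
  corr (gT * hT)%type (fun p => u p.1 * u' p.2) (fun p => w p.1 * w' p.2) g
    = corr gT u w g.1 * corr hT u' w' g.2.
Proof.
rewrite /corr mulr_suml -(pair_bigA _ (fun i j =>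
  u i * u' j * (w (g.1^-1 * i)%g * w' (g.2^-1 * j)%g))) /=.
by apply: eq_bigr => i _; rewrite mulr_sumr; apply: eq_bigr => j _; ring.
Qed.

Lemma corr_inj (gT hT : finGroupType) (phi : {morphism [set: gT] >-> hT})
    (w : hT -> int) (g : gT) :
  bijective phi -> corr gT (w \o phi) (w \o phi) g = corr hT w w (phi g).
Proof.
move=> bij; rewrite /corr (reindex phi) /=; last exact: onW_bij.
by apply: eq_bigr => h _; rewrite morphM ?inE // morphV ?inE.
Qed.

(** Compared coefficient by coefficient, the identity for D D^-1 is the hypothesis on [corr]. *)
Lemma signed_difference_set_of_corr (gT : finGroupType) (k : nat) (lam : int)
    (f : gT -> int) :
    (forall g, [\/ f g = 0, f g = 1 | f g = -1]) ->
    (forall g, corr gT f f g = lam + (g == 1%g)%:R * (k%:Z - lam)) ->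
  signed_difference_set #|gT| k lam [ffun g => f g].
Proof.
move=> fval fcorr; split=> //.
pose S := [pred g | f g != 0].
have cardS : #|S| = k.
  (* At the identity the hypothesis says that the squares of [f] sum to k, and these squares are the
     indicator of the support. *)
  have := fcorr 1%g; rewrite eqxx mul1r addrC subrK => Ek.
  apply/eqP; rewrite -eqz_nat -Ek /corr -sum1_card -natz natr_sum big_mkcond /=.
  apply/eqP; apply: eq_bigr => h _; rewrite !inE invg1 mul1g.
  by case: (fval h) => ->.
case: k / cardS fcorr => fcorr.
exists (fun i => f (enum_val i)), (fun i => enum_val i).
(* Taking [e] to be the identity map gives D, and taking inversion gives D^-1. *)
have sumE (e : gT -> gT) :
    signed_sum (fun i : 'I_#|S| => f (enum_val i)) (fun i => e (enum_val i))
    = \sum_g zg_elt (e g) *~ f g.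
  rewrite /signed_sum -(big_enum_val (fun g => zg_elt (e g) *~ f g)).
  rewrite big_mkcond /=; apply: eq_bigr => g _; rewrite inE.
  by case: eqP => // ->; rewrite mulr0z.
have coefE (e : gT -> gT) : involutive e -> forall g,
    (\sum_h zg_elt (e h) *~ f h : zgring gT) g = f (e g).
  move=> eK g; rewrite sum_ffunE (bigD1 (e g)) //= big1 => [|h hg].
    by rewrite addr0 ffunMzE ffunE eK eqxx intz.
  by rewrite ffunMzE ffunE -(can_eq eK) eK eq_sym (negPf hg) mul0rz.
split.
- exact: enum_val_inj.
- move=> i; have := enum_valP i; rewrite inE.
  by case: (fval (enum_val i)) => ->; [|right|left].
- by rewrite (sumE id); apply/ffunP=> g; rewrite ffunE (coefE id).
- rewrite sumE; apply/ffunP=> g; rewrite ffunE.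
  under eq_bigr => h _ do rewrite ffunE (coefE _ (@invgK gT)) invMg invgK.
  rewrite -/(corr gT f f g) fcorr /zg_set ffunE !ffunMzE sum_ffunE.
  rewrite (bigD1 g) ?inE //= big1 => [|h /andP[_ hg]]; last first.
    by rewrite ffunE eq_sym (negPf hg).
  by rewrite !ffunE eqxx addr0 intz -mulrzr intz.
Qed.

End Correlation.

(** * The quadratic character in odd order and its autocorrelation *)

Section QuadraticCharacter.
Local Open Scope ring_scope.
Variable K : finFieldType.
Hypothesis oddK : odd #|K|.

(** Euler's criterion: for [#|K|] odd, this power is 1 exactly at the nonzero squares. *)
Definition qchar (x : K) : int :=
  if x == 0 then 0 else if x ^+ #|K|.-1./2 == 1 then 1 else -1.

Lemma qchar0 : qchar 0 = 0.
Proof. by rewrite /qchar eqxx. Qed.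

Lemma qchar1 : qchar 1 = 1.
Proof. by rewrite /qchar oner_eq0 expr1n eqxx. Qed.

Lemma qchar_val x : [\/ qchar x = 0, qchar x = 1 | qchar x = -1].
Proof.
by rewrite /qchar; do 2?case: ifP => _; [constructor 1|constructor 2|constructor 3].
Qed.

Lemma double_half_card : (#|K|.-1./2).*2 = #|K|.-1.
Proof.
apply: even_halfK; have := oddK; have := finNzRing_gt1 K.
by case: #|K| => //= n _; rewrite negbK.
Qed.

Lemma expf_half_card (x : K) : x != 0 ->
  x ^+ #|K|.-1./2 = 1 \/ x ^+ #|K|.-1./2 = -1.
Proof.
move=> x0; have: (x ^+ #|K|.-1./2) ^+ 2 == 1.
  rewrite -exprM muln2 double_half_card -(inj_eq (mulfI x0)) mulr1 -exprS.
  by rewrite prednK ?expf_card // (ltn_trans _ (finNzRing_gt1 K)).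
by rewrite sqrf_eq1 => /orP[] /eqP; [left|right].
Qed.

Lemma qcharM x y : qchar (x * y) = qchar x * qchar y.
Proof.
rewrite /qchar mulf_eq0; case: eqP => [_|/eqP x0]; first by rewrite mul0r.
case: eqP => [_|/eqP y0] /=; first by rewrite mulr0.
rewrite exprMn; case: (expf_half_card x x0) => ->.
  by rewrite mul1r eqxx mul1r.
case: (expf_half_card y y0) => ->; rewrite ?mulr1 ?mulrNN ?mulr1 ?eqxx ?mulr1 //.
by case: eqP.
Qed.

(** With e = (q - 1)/2, the polynomial X^e - 1 has at most e roots, fewer than the q - 1 nonzero
    elements. *)
Lemma qchar_nonresidue : exists2 z, z != 0 & qchar z = -1.
Proof.
set e := #|K|.-1./2.
have [e0 eK] : (0 < e)%N /\ (e < #|K|.-1)%N.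
  have K1 : (1 < #|K|)%N := finNzRing_gt1 K.
  by have := double_half_card; rewrite -/e; lia.
have [z /andP[z0 z1]|none] := pickP [pred z : K | (z != 0) && (z ^+ e != 1)].
  by exists z => //; rewrite /qchar (negPf z0) (negPf z1).
have: (size (enum (predC1 (0%R : K))) <= e)%N.
  apply: max_unity_roots; rewrite ?enum_uniq //; apply/allP=> z.
  rewrite mem_enum inE => z0; apply/unity_rootP/eqP.
  by have := none z; rewrite /= z0 => /negbFE.
by rewrite -cardE cardC1 leqNgt eK.
Qed.

(** Multiplication by a nonresidue permutes the field and negates the sum. *)
Lemma sum_qchar : \sum_x qchar x = 0.
Proof.
have [z z0 zN] := qchar_nonresidue.
have E : \sum_x qchar x = - \sum_x qchar x.
  rewrite {1}(reindex_inj (mulfI z0)) -sumrN.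
  by apply: eq_bigr => x _; rewrite qcharM zN mulN1r.
lia.
Qed.

Lemma qchar_sqr x : qchar x * qchar x = (x != 0)%:R.
Proof. by rewrite /qchar; case: eqP => //= _; case: ifP. Qed.

(* For a <> 0, η(x) η(x - a) = η(1 - a/x) when x <> 0, and 1 - a/x runs over
   all elements but 1. *)
Lemma corr_qchar (a : K) :
  corr (additive_group K) qchar qchar a = #|K|%:Z * (a == 0)%:R - 1.
Proof.
have -> : corr (additive_group K) qchar qchar a
    = \sum_(x : K) qchar x * qchar (- a + x) by [].
have [->|a0] := eqVneq a 0.
  under eq_bigr => x _ do rewrite oppr0 add0r qchar_sqr.
  rewrite (bigD1 0) //= eqxx add0r (eq_bigr (fun=> 1)) => [|x -> //].
  rewrite sumr_const (cardC1 (0 : K)) mulr1 natz.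
  exact: predn_int (ltnW (finNzRing_gt1 K)).
rewrite mulr0 add0r (bigD1 0) //= qchar0 mul0r add0r.
(* Since η(1) = 1, the target -1 is the sum of η(u) over u <> 1. *)
have := sum_qchar; rewrite (bigD1 1) //= qchar1 => /eqP.
rewrite addrC addr_eq0 => /eqP <-.
rewrite (reindex_onto (fun u => a / (1 - u)) (fun x => 1 - a / x)) /=; last first.
  by move=> x x0; field; rewrite x0 opprB addrCA subrr addr0 a0.
(* Because 0^-1 = 0, the value u = 1 is sent to x = 0, so the condition x <> 0 excludes exactly u =
   1. *)
apply: eq_big => u.
  rewrite mulf_eq0 invr_eq0 (negPf a0) /= subr_eq0 [1 == u]eq_sym.
  have [//|u1] := eqVneq u 1; apply/eqP; field.
  by rewrite a0 subr_eq0 eq_sym u1.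
move=> /andP[]; rewrite mulf_eq0 invr_eq0 (negPf a0) /= => u1 _.
have -> : - a + a / (1 - u) = a / (1 - u) * u by field.
by rewrite (qcharM _ u) mulrA qchar_sqr mulf_neq0 ?invr_eq0 ?mul1r.
Qed.

End QuadraticCharacter.

(** * The three-layer construction *)

Section Construction.
Local Open Scope ring_scope.
Variable K : finFieldType.
Hypothesis oddK : odd #|K|.

(** Each layer of D is a function of x times a function of y, so its correlations factor by
    [corr_prod]; [layer1] and [layer2] are the two factors. *)
Definition layer1 (t : nat) (x : K) : int :=
  match t with 0 => (x == 0)%:R | 1 => 1 | _ => qchar K x end.

Definition layer2 (t : nat) (y : K) : int :=
  match t with 0 => 1 | 1 => (y == 0)%:R | _ => qchar K y end.

Lemma corrE (u w : K -> int) (a : K) :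
  corr (additive_group K) u w a = \sum_x u x * w (x - a).
Proof. by apply: eq_bigr => x _; rewrite [x - a]addrC. Qed.

Lemma sum_deltal (u : K -> int) : \sum_x (x == 0)%:R * u x = u 0.
Proof.
rewrite (bigD1 0) //= eqxx mul1r big1 ?addr0 // => x /negPf->.
by rewrite mul0r.
Qed.

Lemma sum_shift (u : K -> int) (a : K) : \sum_x u (x - a) = \sum_x u x.
Proof. by rewrite [RHS](reindex_inj (addIr (- a))). Qed.

Let T : finGroupType := (additive_group K * additive_group K * 'Z_3)%type.

Definition sds_fun (p : T) : int := layer1 p.2 p.1.1 * layer2 p.2 p.1.2.

Lemma sds_fun_val p : [\/ sds_fun p = 0, sds_fun p = 1 | sds_fun p = -1].
Proof.
case: p => -[x y] [[|[|t]] lt]; rewrite /sds_fun /layer1 /layer2 /=.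
- by case: eqP; [constructor 2|constructor 1].
- by case: eqP; [constructor 2|constructor 1].
- case: (qchar_val K x) => ->; case: (qchar_val K y) => ->;
  rewrite ?mul0r ?mulr0 ?mul1r ?mulN1r ?opprK; by [constructor 1|constructor 2|constructor 3].
Qed.

Lemma corr_sds_fun (g : T) :
  corr T sds_fun sds_fun g
  = 1 + (g == 1%g)%:R * ((#|K| ^ 2 + 1)%:Z - 1).
Proof.
pose c1 (t t' : nat) := corr (additive_group K) (layer1 t) (layer1 t') g.1.1.
pose c2 (t t' : nat) := corr (additive_group K) (layer2 t) (layer2 t') g.1.2.
(* Translation by [g] also shifts the index in ['Z_3], so layer t meets layer t - [g.2]. *)
transitivity (\sum_(t : 'Z_3) c1 t (- g.2 + t)%R * c2 t (- g.2 + t)%R).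
  rewrite {}/c1 {}/c2 /corr.
  rewrite -(pair_bigA _ (fun p t =>
    sds_fun (p, t) * sds_fun (g^-1 * (p, t))%g)) /=.
  rewrite exchange_big; apply: eq_bigr => t _ /=.
  by rewrite -(corr_prod _ _ _ _ _ _ g.1).
have c1C t t' : c1 t t' = \sum_x layer1 t x * layer1 t' (x - g.1.1).
  exact: corrE.
have c2C t t' : c2 t t' = \sum_x layer2 t x * layer2 t' (x - g.1.2).
  exact: corrE.
move: c1 c2 c1C c2C; case: g => -[a b] c c1 c2 /= c1C c2C.
rewrite !big_ord_recl big_ord0 /=.
have sum1 : \sum_(x : K) (x == 0)%:R = 1 :> int.
  by have := sum_deltal (fun=> 1); under eq_bigr do rewrite mulr1.
have card1 : \sum_(x : K) 1 * 1 = #|K|%:Z :> int.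
  by rewrite mulr1 sumr_const natz.
have shift1 (u : K -> int) (d : K) : \sum_x 1 * u (x - d) = \sum_x u x.
  by rewrite -(sum_shift u d); apply: eq_bigr => x _; rewrite mul1r.
have mul1 (u : K -> int) : \sum_x u x * 1 = \sum_x u x.
  by apply: eq_bigr => x _; rewrite mulr1.
have delta (d : K) :
    \sum_(x : K) (x == 0%R)%:R * (x - d == 0%R)%:R = (d == 0%R)%:R :> int.
  by rewrite (sum_deltal (fun x => (x - d == 0)%:R)) sub0r oppr_eq0.
have qcorr (d : K) :
    \sum_x qchar K x * qchar K (x - d) = #|K|%:Z * (d == 0)%:R - 1.
  by rewrite -corrE corr_qchar.
have oneE (x y : K) (t : 'Z_3) :
  ((x, y, t) == 1%g :> T) = [&& x == 0, y == 0 & t == 0] by rewrite andbA.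
case: c c1 c2 c1C c2C => [[|[|[|//]]]] lt c1 c2 c1C c2C.
- rewrite [LHS](_ : _ = c1 0%N 0%N * c2 0%N 0%N
    + (c1 1%N 1%N * c2 1%N 1%N + (c1 2%N 2%N * c2 2%N 2%N + 0))) //.
  rewrite !c1C !c2C /= !delta card1 !qcorr (oneE a b) !andbT.
  by case: eqP => _; case: eqP => _ /=; rewrite PoszD -mulnn PoszM; ring.
(* For a nonzero shift, two of the three pairs involve the layer of η and vanish; the pair of layers
   0 and 1 gives 1. *)
- rewrite [LHS](_ : _ = c1 0%N 2%N * c2 0%N 2%N
    + (c1 1%N 0%N * c2 1%N 0%N + (c1 2%N 1%N * c2 2%N 1%N + 0))) //.
  rewrite !c1C !c2C /= !mul1 (shift1 (qchar K)).
  rewrite (shift1 (fun x => (x == 0)%:R)) sum_qchar // sum1.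
  by rewrite (oneE a b) !andbF !(mulr0, mul0r, addr0, add0r).
- rewrite [LHS](_ : _ = c1 0%N 1%N * c2 0%N 1%N
    + (c1 1%N 2%N * c2 1%N 2%N + (c1 2%N 0%N * c2 2%N 0%N + 0))) //.
  rewrite !c1C !c2C /= !mul1 (shift1 (qchar K)).
  rewrite (shift1 (fun x => (x == 0)%:R)) sum_qchar // sum1.
  by rewrite (oneE a b) !andbF !(mulr0, mul0r, addr0, add0r).
Qed.

End Construction.

(** * Transport to the additive group of the given field *)

Lemma abelem_additive (K : finFieldType) (p : nat) :
  prime p -> p \in [pchar K]%R -> p.-abelem%g [set: additive_group K].
Proof.
move=> p_pr pK; apply/abelemP => //; split.
  by apply/centsP=> x _ y _; apply: (addrC (x : K)).
by move=> x _; rewrite FinRing.zmodXgE mulrn_pchar.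
Qed.

Theorem theorem4p1 (m : nat) (m_gt0 : 0 < m) (m_even : ~~ odd m)
    (F : finFieldType) (cardF : #|F| = 3 ^ (2 * m + 1)) :
  exists D : zgring (additive_group F),
    signed_difference_set (3 ^ (2 * m + 1)) (3 ^ (2 * m) + 1) 1%:Z%R D.
Proof.
have [K pK cardK] := pPrimePowerField (p := 3) (k := m) isT m_gt0.
have oddK : odd #|K| by rewrite cardK oddX orbT.
pose T : finGroupType := (additive_group K * additive_group K * 'Z_3)%type.
have pF := card_finPcharP cardF isT.
have cardT : #|T| = #|additive_group F|.
  by rewrite !card_prod cardF card_ord cardK -expnD -expnSr addnn -mul2n addn1.
have abT : 3.-abelem%g [set: T].
  apply/abelemP => //; split.
    apply/centsP=> -[[x y] t] _ [[x' y'] t'] _.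
    by congr (_, _, _); apply: addrC.
  move=> [[x y] t] _; rewrite -[LHS]/(x *+ 3, y *+ 3, t *+ 3)%R.
  by rewrite !(mulrn_pchar pK) -mulr_natr pchar_Zp ?mulr0.
(* Elementary abelian 3-groups of equal order are isomorphic. *)
have /isogP[phi inj_phi im_phi] : [set: additive_group F] \isog [set: T].
  rewrite (isog_abelem_card _ (abelem_additive _ _ _ pF)) // abT /=.
  by rewrite !cardsT cardT.
have bij_phi : bijective phi.
  apply: inj_card_bij; last by rewrite cardT.
  by move=> x y; apply: (injmP inj_phi); rewrite inE.
exists [ffun g => (sds_fun K \o phi) g].
rewrite -cardF; apply: signed_difference_set_of_corr => g.
  exact: sds_fun_val.
rewrite corr_inj // corr_sds_fun // cardK -expnM mulnC.
by rewrite -(morph1 phi) (inj_eq (bij_inj bij_phi)).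
Qed.
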